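(* Let $\alpha\in[0,1]$, let $\mathcal H=\{(w_i,s_i,q_i)\}_{i=1}^T$ be a history with $\mathcal F_\alpha^Q(\mathcal H)\neq\varnothing$, let $i\in\{1,\dots,T\}$, and let $$\eta_i^{\mathrm{crit}}=\sup_{F\in\mathcal F_\alpha^Q(\mathcal H)}\mathrm{dist}(s_i,\mathcal S_F(w_i)).$$ For a radius $\eta_i\ge0$: if $\eta_i<\eta_i^{\mathrm{crit}}$, the restriction $\mathrm{dist}(s_i,\mathcal S_F(w_i))\le\eta_i$ excludes at least one $F\in\mathcal F_\alpha^Q(\mathcal H)$; if $\eta_i\ge\eta_i^{\mathrm{crit}}$, the restriction is redundant (every $F\in\mathcal F_\alpha^Q(\mathcal H)$ satisfies it). If moreover $\alpha>0$ and $[\underline r_i^Q,\overline r_i^Q]$ is the Q-feasible response-price range to $w_i$, then $$\eta_i^{\mathrm{crit}}=\max\{s_i-\underline r_i^Q,\ \overline r_i^Q-s_i\}.$$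
   Context: Setting. Consumer valuations have distribution $F$ with density $f$ and tail demand $\bar F=1-F$. $\mathcal S_F(w)=\arg\max_{s\ge w}(s-w)\bar F(s)$, assumed nonempty and compact; for $\alpha>0$ and $\alpha$-regular $F$ it is a singleton. $F$ is $\alpha$-regular if $s\mapsto(1-\alpha)s-\bar F(s)/f(s)$ is nondecreasing. A history satisfies $s_1<\cdots<s_T$, $1>q_1>\cdots>q_T>0$, $s_i>w_i$. $\mathcal F_\alpha^Q(\mathcal H)=\{F\ \alpha\text{-regular}:\bar F(s_i)=q_i\ \forall i\}$. $\mathrm{dist}(s,S)=\inf_{r\in S}|s-r|$. The price-error (PE) set with radii $\boldsymbol\eta$ is $\{F\in\mathcal F_\alpha^Q(\mathcal H):\mathrm{dist}(s_i,\mathcal S_F(w_i))\le\eta_i\ \forall i\}$. For $\alpha>0$, the Q-feasible response-price range to $w_i$ has endpoints $\underline r_i^Q=\inf_{F\in\mathcal F_\alpha^Q(\mathcal H)}S_F(w_i)$ and $\overline r_i^Q=\sup_{F\in\mathcal F_\alpha^Q(\mathcal H)}S_F(w_i)$, where $S_F(w_i)$ is the unique element of $\mathcal S_F(w_i)$. *)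

(* Defs.v *)
From mathcomp Require Import all_boot all_order all_algebra.
From mathcomp Require Import all_classical all_reals all_analysis.

Set Implicit Arguments.
Unset Strict Implicit.
Unset Printing Implicit Defensive.

Import Order.TTheory GRing.Theory Num.Theory.
Import numFieldNormedType.Exports.

Local Open Scope ring_scope.
Local Open Scope classical_set_scope.

(* A distribution of valuations is its law, a Borel probability on R; the
   cumulative distribution function is x |-> F `]-oo, x]. *)
Notation law R := (probability (measurableTypeR R) R).

Definition tail (R : realType) (F : law R) (s : R) : R :=
  1 - fine (F `]-oo, s]%classic).

Definition is_density (R : realType) (F : law R) (f : R -> R) : Prop :=
  [/\ measurable_fun setT f,
      forall x, 0 <= f x &
      forall A : set (measurableTypeR R), measurable A ->
        F A = (\int[lebesgue_measure]_(x in A) (f x)%:E)%E].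

Definition optimal_prices (R : realType) (F : law R) (w : R) : set R :=
  [set s | w <= s /\
     forall t, w <= t -> (t - w) * tail F t <= (s - w) * tail F s].

(* When tail F w = 0 every price s >= w yields zero profit and the maximizers
   form the ray [w, +oo[, so compactness can only be asked for where some
   demand is left. *)
Definition valuation_law (R : realType) (F : law R) : Prop :=
  (exists f, is_density F f) /\
  forall w, 0 < tail F w ->
    optimal_prices F w !=set0 /\ compact (optimal_prices F w).

(* Extended-real division has q / 0 = +oo for q > 0, so the value is -oo where
   the density vanishes while some demand is left. *)
Definition alpha_virtual_value (R : realType) (alpha : R) (F : law R)
    (f : R -> R) (s : R) : \bar R :=
  (((1 - alpha) * s)%:E - (tail F s)%:E / (f s)%:E)%E.

(* A density is determined only almost everywhere: F is regular when some
   version of its density makes the virtual value nondecreasing. The quotient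
   is 0 / 0 once tail F s = 0, so monotonicity is required where tail F > 0. As
   the virtual value is -oo where the density vanishes, F then has no gap in
   its support. *)
Definition alpha_regular (R : realType) (alpha : R) (F : law R) : Prop :=
  exists2 f, is_density F f &
    forall s t, s <= t -> 0 < tail F t ->
      (alpha_virtual_value alpha F f s <= alpha_virtual_value alpha F f t)%E.

(* Wholesale prices w, retail prices s and demands q, indexed by 0, ..., T-1. *)
Record history (R : realType) (T : nat) := History {
  wcost : 'I_T -> R;
  price : 'I_T -> R;
  demand : 'I_T -> R;
  price_incr : forall i j : 'I_T, (i < j)%N -> price i < price j;
  demand_decr : forall i j : 'I_T, (i < j)%N -> demand j < demand i;
  demand_gt0 : forall i, 0 < demand i;
  demand_lt1 : forall i, demand i < 1;
  wcost_lt_price : forall i, wcost i < price i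
}.

Definition feasible (R : realType) (T : nat) (alpha : R) (H : history R T) :
    set (law R) :=
  [set F | [/\ valuation_law F, alpha_regular alpha F &
               forall i, tail F (price H i) = demand H i]].

Definition dist (R : realType) (s : R) (S : set R) : \bar R :=
  ereal_inf [set `|s - r|%:E | r in S].

Definition price_error (R : realType) (T : nat) (H : history R T) (i : 'I_T)
    (F : law R) : \bar R :=
  dist (price H i) (optimal_prices F (wcost H i)).

(* May be +oo. *)
Definition eta_crit (R : realType) (T : nat) (alpha : R) (H : history R T)
    (i : 'I_T) : \bar R :=
  ereal_sup [set price_error H i F | F in feasible alpha H].

(* The unique element of optimal_prices F w whenever that set is a singleton. *)
Definition response_price (R : realType) (F : law R) (w : R) : R :=
  get (optimal_prices F w).

Definition response_lower (R : realType) (T : nat) (alpha : R)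
    (H : history R T) (i : 'I_T) : \bar R :=
  ereal_inf [set (response_price F (wcost H i))%:E | F in feasible alpha H].

Definition response_upper (R : realType) (T : nat) (alpha : R)
    (H : history R T) (i : 'I_T) : \bar R :=
  ereal_sup [set (response_price F (wcost H i))%:E | F in feasible alpha H].

(* Main.v *)
(* For alpha > 0 the sign of (s - w) f(s) - F-bar(s), minus the slope of the
   profit, changes at most once, and it does so with a strict margin: the
   function s - w - F-bar(s)/f(s) is alpha s plus a nondecreasing function. If
   s1 < s2 were two maximizers, then according to its sign at their midpoint
   either the profit decreases strictly just before s2 or it increases strictly
   just after s1. Hence the best response r is unique, the price error is
   |s_i - r|, and its supremum is read off the infimum and the supremum of r. *)

Require Import Defs.
From mathcomp Require Import all_boot all_order all_algebra.
From mathcomp Require Import all_classical all_reals all_analysis.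
From mathcomp Require Import measurable_realfun ring lra.

Set Implicit Arguments.
Unset Strict Implicit.
Unset Printing Implicit Defensive.

Import Order.TTheory GRing.Theory Num.Theory.
Import numFieldNormedType.Exports.

Local Open Scope classical_set_scope.
Local Open Scope ring_scope.

(** * Tail and profit increments over an interval *)

Lemma tail_sub (R : realType) (F : law R) (a b : R) :
  a <= b -> ((tail F a - tail F b)%:E = F `]a, b]%classic)%E.
Proof.
move=> ab; have fnm (A : set (measurableTypeR R)) : measurable A ->
  F A \is a fin_num by exact: fin_num_measure.
have ma : measurable (`]-oo, a]%classic : set (measurableTypeR R)).
  exact: measurable_itv.
have mab : measurable (`]a, b]%classic : set (measurableTypeR R)).
  exact: measurable_itv.
have E : F `]-oo, b]%classic = (F `]-oo, a]%classic + F `]a, b]%classic)%E.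
  rewrite -measureU //.
    by rewrite -itv_bndbnd_setU// bnd_simp.
  apply/seteqP; split => // x [] /=; rewrite !in_itv/=; lra.
rewrite /tail E fineD ?fnm// -[RHS]fineK ?fnm//.
by congr EFin; ring.
Qed.

Lemma lebesgue_measure_itvoc (R : realType) (a b : R) :
  a <= b -> (lebesgue_measure (`]a, b]%classic : set R) = (b - a)%:E)%E.
Proof.
move=> ab; rewrite lebesgue_measure_itv/= lte_fin; case: ltP => // ba.
by congr EFin; lra.
Qed.

Lemma tail_ge (R : realType) (F : law R) (f : R -> R) (a b k : R) :
  is_density F f -> a <= b -> 0 <= k ->
  (forall x, a < x <= b -> k <= f x) -> k * (b - a) <= tail F a - tail F b.
Proof.
move=> [mf f0 Ff] ab k0 kf.
have mab : measurable (`]a, b]%classic : set (measurableTypeR R)).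
  exact: measurable_itv.
rewrite -lee_fin tail_sub// Ff// EFinM -lebesgue_measure_itvoc//.
rewrite -integral_cst//; apply: ge0_le_integral => //=.
by apply/measurable_EFinP; exact: measurable_funS mf.
Qed.

Lemma tail_le (R : realType) (F : law R) (f : R -> R) (a b k : R) :
  is_density F f -> a <= b ->
  (forall x, a < x <= b -> f x <= k) -> tail F a - tail F b <= k * (b - a).
Proof.
move=> [mf f0 Ff] ab kf.
have mab : measurable (`]a, b]%classic : set (measurableTypeR R)).
  exact: measurable_itv.
rewrite -lee_fin tail_sub// Ff// EFinM -lebesgue_measure_itvoc//.
rewrite -integral_cst//; apply: ge0_le_integral => //=.
- by move=> x _; rewrite lee_fin.
- by apply/measurable_EFinP; exact: measurable_funS mf.
Qed.

Lemma tail_nonincreasing (R : realType) (F : law R) (a b : R) :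
  a <= b -> tail F b <= tail F a.
Proof. by move=> ab; rewrite -subr_ge0 -lee_fin tail_sub. Qed.

(* With the margin d, monotonicity of the tail gives the bound over a whole step
   shorter than d, so the profit need not be integrated by parts. *)
Lemma profit_decr (R : realType) (F : law R) (f : R -> R) (w a b d : R) :
  is_density F f -> a < b -> b - a < d -> 0 < tail F b ->
  (forall x, a < x <= b -> tail F x <= f x * (x - w - d)) ->
  (b - w) * tail F b < (a - w) * tail F a.
Proof.
move=> Ff ab bad Gb0 Hf; have f0 x : 0 <= f x by case: Ff.
(* At [x = b] the hypothesis bounds a positive tail by [f b * (b - w - d)] with [0 <= f b]. *)
have cpos : 0 < b - w - d.
  have /Hf Hb : a < b <= b by rewrite ab lexx.
  by have := f0 b; nra.
have Hk : forall x, a < x <= b -> tail F b / (b - w - d) <= f x.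
  move=> x axb; rewrite ler_pdivrMr//.
  have := Hf _ axb; case/andP: axb => ax xb.
  have := tail_nonincreasing F xb; have := f0 x; nra.
have k0 : 0 < tail F b / (b - w - d) by rewrite divr_gt0.
have := tail_ge Ff (ltW ab) (ltW k0) Hk.
have : tail F b = tail F b / (b - w - d) * (b - w - d).
  by rewrite mulfVK// gt_eqF.
move: (_ / _) k0 {Hk} => k k0 Gk Hd.
(* With [k = tail F b / (b - w - d)], the profit drops by [(a - w) * (tail F a - tail F b) - (b - a)
   * tail F b], which is at least [k * (b - a) * (d - (b - a))]. *)
have : 0 < k * (b - a) * (a - w - (b - w - d)) by rewrite !mulr_gt0//; lra.
have : 0 <= (tail F a - tail F b - k * (b - a)) * (a - w).
  by rewrite mulr_ge0//; lra.
rewrite {}Gk; nra.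
Qed.

(** Mirror image of [profit_decr]: the density is now bounded above, by the quotient at the left
    end, and [w <= a] keeps the denominators positive. *)
Lemma profit_incr (R : realType) (F : law R) (f : R -> R) (w a b d : R) :
  is_density F f -> w <= a -> a < b -> b - a < d -> 0 < tail F a ->
  (forall x, a < x <= b -> f x * (x - w + d) <= tail F x) ->
  (a - w) * tail F a < (b - w) * tail F b.
Proof.
move=> Ff wa ab bad Ga0 Hf; have f0 x : 0 <= f x by case: Ff.
have cpos : 0 < a - w + d by lra.
have Hk : forall x, a < x <= b -> f x <= tail F a / (a - w + d).
  move=> x axb; rewrite ler_pdivlMr//.
  have := Hf _ axb; case/andP: axb => ax xb.
  have := tail_nonincreasing F (ltW ax); have := f0 x; nra.
have := tail_le Ff (ltW ab) Hk.
have : tail F a = tail F a / (a - w + d) * (a - w + d).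
  by rewrite mulfVK// gt_eqF.
have : 0 < tail F a / (a - w + d) by rewrite divr_gt0.
move: (_ / _) {Hk} => k k0 Gk Hd.
have : 0 < k * (b - a) * (d - (b - a)) by rewrite !mulr_gt0//; lra.
have : 0 <= (k * (b - a) - (tail F a - tail F b)) * (b - w).
  by rewrite mulr_ge0//; lra.
rewrite {}Gk; nra.
Qed.

(** * Uniqueness of the best response *)

Lemma virtual_value_mono (R : realType) (alpha : R) (F : law R) (f : R -> R)
    (s t : R) :
  0 < f s -> 0 <= f t -> 0 < tail F t ->
  (alpha_virtual_value alpha F f s <= alpha_virtual_value alpha F f t)%E ->
  0 < f t /\
  (1 - alpha) * s - tail F s / f s <= (1 - alpha) * t - tail F t / f t.
Proof.
move=> fs ft0 Gt; rewrite /alpha_virtual_value !inver (gt_eqF fs).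
(* If [f t] were 0, the right side would be -oo and the left side real; so positivity of the density
   passes from [s] to [t]. *)
case: eqP => [_|/eqP ft]; first by rewrite gt0_muley ?lte_fin.
by rewrite -!EFinM -!EFinB lee_fin lt_neqAle eq_sym ft ft0.
Qed.

Lemma optimal_prices_no_lt (R : realType) (alpha : R) (F : law R)
    (w p s1 s2 : R) :
  0 < alpha -> alpha_regular alpha F -> w < p -> 0 < tail F p ->
  optimal_prices F w s1 -> optimal_prices F w s2 -> ~ s1 < s2.
Proof.
move=> a0 [f Ff Fr] wp Gp [ws1 max1] [ws2 max2] s12.
have f0 x : 0 <= f x by case: Ff.
(* The price [p] earns a positive profit, so no maximizer has zero demand; the tail is then positive
   up to [s2]. *)
have Pp : 0 < (p - w) * tail F p by rewrite mulr_gt0// subr_gt0.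
have G2 : 0 < tail F s2.
  have := max2 p (ltW wp); move/(lt_le_trans Pp).
  by rewrite pmulr_rgt0//; have := max1 p (ltW wp); lra.
have G x : x <= s2 -> 0 < tail F x.
  by move=> xs; exact: lt_le_trans G2 (tail_nonincreasing F xs).
pose m := (s1 + s2) / 2.
have s1m : s1 < m by rewrite /m; lra.
have ms2 : m < s2 by rewrite /m; lra.
have [psi|psi] := leP (tail F m) (f m * (m - w)).
- have fm : 0 < f m.
    by rewrite lt_neqAle f0 andbT; apply/negP => /eqP E; have := G _ (ltW ms2);
       move: psi; rewrite -E mul0r; lra.
  (* Beyond [m'], regularity from [m] on yields the margin [d]. *)
  pose m' := (m + s2) / 2; pose d := alpha * (m' - m).
  have d0 : 0 < d by rewrite mulr_gt0// /m'; lra.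
  (* The step from [a] to [s2] must stay beyond [m'] and be shorter than [d]. *)
  pose a := Num.max m' (s2 - d / 2).
  have am' : m' <= a by rewrite le_max lexx.
  have ad : s2 - d / 2 <= a by rewrite le_max lexx orbT.
  have as2 : a < s2 by rewrite gt_max; apply/andP; split; rewrite /m'; lra.
  have : (s2 - w) * tail F s2 < (a - w) * tail F a.
    apply: (@profit_decr _ _ f _ _ _ d) => //; first lra.
    move=> x /andP[ax xs2].
    have mx : m <= x by rewrite /m' in am'; lra.
    have [fx] := virtual_value_mono fm (f0 x) (G _ xs2) (Fr _ _ mx (G _ xs2)).
    move=> V; have psi' : tail F m / f m <= m - w.
      by rewrite ler_pdivrMr// mulrC.
    rewrite mulrC -ler_pdivrMr//.
    have : alpha * (m' - m) <= alpha * (x - m).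
      by rewrite ler_pM2l//; lra.
    by rewrite /d; lra.
  by rewrite ltNge max2//; rewrite /m' in am'; lra.
(* The same argument reflected: the margin holds before [m'], and the short step starts at [s1]. *)
- pose m' := (s1 + m) / 2; pose d := alpha * (m - m').
  have d0 : 0 < d by rewrite mulr_gt0// /m'; lra.
  pose b := Num.min m' (s1 + d / 2).
  have bm' : b <= m' by rewrite ge_min lexx.
  have bd : b <= s1 + d / 2 by rewrite ge_min lexx orbT.
  have s1b : s1 < b by rewrite lt_min; apply/andP; split; rewrite /m'; lra.
  have : (s1 - w) * tail F s1 < (b - w) * tail F b.
    apply: (@profit_incr _ _ f _ _ _ d) => //; [lra|exact: G (ltW s12)|].
    move=> x /andP[sx xb].
    have xm : x <= m by rewrite /m' in bm'; lra.
    have Gm := G _ (ltW ms2).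
    (* Where the density vanishes the virtual value is -oo and says nothing, but the required bound
       is then just positivity of the tail. *)
    have [fx0|fx] := leP (f x) 0.
      have -> : f x = 0 by apply/le_anti; rewrite fx0 f0.
      by rewrite mul0r ltW// G//; exact: le_trans xm (ltW ms2).
    have [fm V] := virtual_value_mono fx (f0 m) Gm (Fr _ _ xm Gm).
    have psi' : m - w < tail F m / f m by rewrite ltr_pdivlMr// mulrC.
    rewrite mulrC -ler_pdivlMr//.
    have : alpha * (m - m') <= alpha * (m - x).
      by rewrite ler_pM2l//; lra.
    by rewrite /d; lra.
  by rewrite ltNge max1//; lra.
Qed.

Lemma optimal_prices_unique (R : realType) (alpha : R) (F : law R) (w p : R) :
  0 < alpha -> valuation_law F -> alpha_regular alpha F ->
  w < p -> 0 < tail F p ->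
  optimal_prices F w = [set response_price F w].
Proof.
move=> a0 [_ exF] Fr wp Gp.
(* Demand at [w] is at least that at [p], so a maximizer exists and [get] returns one. *)
have [|[r or] _] := exF w.
  by exact: lt_le_trans Gp (tail_nonincreasing F (ltW wp)).
have oR : optimal_prices F w (response_price F w) by apply: getPex; exists r.
apply/seteqP; split => [x ox /=|x -> //].
have := optimal_prices_no_lt a0 Fr wp Gp ox oR.
have := optimal_prices_no_lt a0 Fr wp Gp oR ox.
by case: (ltgtP x (response_price F w)).
Qed.

(** * The critical radius *)

Lemma price_errorE (R : realType) (T : nat) (alpha : R) (H : history R T)
    (i : 'I_T) (F : law R) :
  0 < alpha -> feasible alpha H F ->
  price_error H i F = `|price H i - response_price F (wcost H i)|%:E.
Proof.
move=> a0 [Fv Fr FH]; rewrite /price_error /dist.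
rewrite (@optimal_prices_unique _ alpha _ _ (price H i))//.
- by rewrite image_set1 ereal_inf1.
- exact: wcost_lt_price.
- by rewrite FH; exact: demand_gt0.
Qed.

Lemma eta_critE (R : realType) (T : nat) (alpha : R) (H : history R T)
    (i : 'I_T) :
  0 < alpha -> feasible alpha H !=set0 ->
  eta_crit alpha H i =
    maxe ((price H i)%:E - response_lower alpha H i)%E
         (response_upper alpha H i - (price H i)%:E)%E.
Proof.
move=> a0 [F0 hF0]; set s := price H i; apply/le_anti/andP; split.
  apply: ge_ereal_sup => _ [F hF <-]; rewrite (price_errorE _ a0 hF).
  rewrite le_max; set r := response_price _ _.
  have lr : (response_lower alpha H i <= r%:E)%E.
    by apply: ereal_inf_lbound; exists F.
  have ru : (r%:E <= response_upper alpha H i)%E.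
    by apply: ereal_sup_ubound; exists F.
  apply/orP; case: (ger0P (s - r)) => _; [left|right].
    by rewrite EFinB leeB.
  by rewrite opprB EFinB leeB.
have ub F : feasible alpha H F ->
    (`|s - response_price F (wcost H i)|%:E <= eta_crit alpha H i)%E.
  by move=> hF; rewrite -(price_errorE _ a0 hF); apply: ereal_sup_ubound;
     exists F.
(* A finite value [e] confines every response to [[s - e, s + e]], which bounds both endpoints of
   the range; +oo is trivial, and [F0] rules out -oo. *)
case: (eta_crit alpha H i) ub => [e| |] ub.
- rewrite ge_max; apply/andP; split.
    have : ((s - e)%:E <= response_lower alpha H i)%E.
      apply: le_ereal_inf_tmp => _ [F hF <-]; rewrite lee_fin.
      by have := ub _ hF; rewrite lee_fin ler_norml => /andP[]; lra.
    case: (response_lower alpha H i) => [l| |] //=; rewrite ?leNye//.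
    by rewrite -EFinB !lee_fin; lra.
  rewrite leeBlDr// -EFinD; apply: ge_ereal_sup => _ [F hF <-].
  rewrite lee_fin; have := ub _ hF.
  by rewrite lee_fin ler_norml => /andP[]; lra.
- by rewrite leey.
- by have := ub _ hF0.
Qed.

Unset Implicit Arguments.

Theorem proposition4 (R : realType) (alpha : R) (T : nat) (H : history R T)
    (i : 'I_T) (halpha : 0 <= alpha <= 1) (hH : feasible alpha H !=set0) :
  (forall eta : R, 0 <= eta ->
     ((eta%:E < eta_crit alpha H i)%E ->
        exists2 F, feasible alpha H F & ~ (price_error H i F <= eta%:E)%E) /\
     ((eta_crit alpha H i <= eta%:E)%E ->
        forall F, feasible alpha H F -> (price_error H i F <= eta%:E)%E)) /\
  (0 < alpha ->
     eta_crit alpha H i =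
       maxe ((price H i)%:E - response_lower alpha H i)%E
            (response_upper alpha H i - (price H i)%:E)%E).
Proof.
split=> [eta _|a0]; last exact: eta_critE.
split=> [/ereal_sup_gt[_ [F hF <-] lt_eta]|le_eta F hF].
  by exists F => //; apply/negP; rewrite -ltNge.
by apply: le_trans le_eta; apply: ereal_sup_ubound; exists F.
Qed.
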